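(* Only finitely many sporadic triangle groups are discrete; that is, there are only finitely many pairs $(p,\tau)$, with $p\ge 2$ an integer and $\tau\in\{\sigma_1,\overline{\sigma}_1,\dots,\sigma_9,\overline{\sigma}_9\}$ such that $H_\tau$ has signature $(2,1)$, for which $\Gamma\left(\frac{2\pi}{p},\tau\right)$ is a discrete subgroup of $\mathrm{SU}(H_\tau)\cong\mathrm{SU}(2,1)$.
   Context: For an integer $p\ge 2$ put $\psi=2\pi/p$, and for $\tau\in\mathbb{C}$ let $$J=\begin{pmatrix}0&0&1\\1&0&0\\0&1&0\end{pmatrix},\qquad R_1=\begin{pmatrix}e^{2i\psi/3}&\tau&-e^{i\psi/3}\overline{\tau}\\0&e^{-i\psi/3}&0\\0&0&e^{-i\psi/3}\end{pmatrix},$$ $$H_\tau=\begin{pmatrix}2\sin(\psi/2)&-ie^{-i\psi/6}\tau&ie^{i\psi/6}\overline{\tau}\\ ie^{i\psi/6}\overline{\tau}&2\sin(\psi/2)&-ie^{-i\psi/6}\tau\\-ie^{-i\psi/6}\tau&ie^{i\psi/6}\overline{\tau}&2\sin(\psi/2)\end{pmatrix}$$ (so $H_\tau$ depends on $p$ as well). Both $R_1$ and $J$ preserve the Hermitian form $\langle \mathbf z,\mathbf w\rangle=\mathbf w^*H_\tau\mathbf z$. The group $\Gamma(2\pi/p,\tau)$ is the group generated by $R_1$ and $J$. The sporadic values are $\sigma_j,\overline{\sigma}_j$ ($1\le j\le 9$), where $\sigma_1=e^{i\pi/3}+e^{-i\pi/6}2\cos(\pi/4)$, $\sigma_2=e^{i\pi/3}+e^{-i\pi/6}2\cos(\pi/5)$,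 $\sigma_3=e^{i\pi/3}+e^{-i\pi/6}2\cos(2\pi/5)$, $\sigma_4=e^{2\pi i/7}+e^{4\pi i/7}+e^{8\pi i/7}$, $\sigma_5=e^{2\pi i/9}+e^{-i\pi/9}2\cos(2\pi/5)$, $\sigma_6=e^{2\pi i/9}+e^{-i\pi/9}2\cos(4\pi/5)$, $\sigma_7=e^{2\pi i/9}+e^{-i\pi/9}2\cos(2\pi/7)$, $\sigma_8=e^{2\pi i/9}+e^{-i\pi/9}2\cos(4\pi/7)$, $\sigma_9=e^{2\pi i/9}+e^{-i\pi/9}2\cos(6\pi/7)$. A sporadic triangle group is a group $\Gamma(2\pi/p,\tau)$ with $p\ge 2$ an integer, $\tau$ a sporadic value, and $H_\tau$ of signature $(2,1)$. *)

(* Defs.v *)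
From HB Require Import structures.
From mathcomp Require Import all_boot all_order all_algebra.
From mathcomp Require Import complex ring.
From mathcomp Require Import boolp classical_sets functions cardinality.
From mathcomp Require Import reals topology normedtype trigo.
Set Implicit Arguments.
Unset Strict Implicit.
Unset Printing Implicit Defensive.

Import Order.TTheory GRing.Theory Num.Theory.
Import numFieldNormedType.Exports.

Local Open Scope classical_set_scope.
Local Open Scope ring_scope.
Local Open Scope sesquilinear_scope.

Section HermitianGroups.
Variable C : numClosedFieldType.

Definition is_subgroup (n : nat) (G : set 'M[C]_n) : Prop :=
  [/\ G `<=` [set A | A \in unitmx],
      G 1%:M,
      (forall A B, G A -> G B -> G (A *m B)) &
      (forall A, G A -> G (invmx A))].

(* Meaningful when [S] consists of invertible matrices; otherwise no subgroup
   contains [S] and the intersection is the set of all matrices. *)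
Definition generated_group (n : nat) (S : set 'M[C]_n) : set 'M[C]_n :=
  smallest (@is_subgroup n) S.

(* With <z, w> = w^* H z, a matrix A preserves the form iff A^* H A = H. *)
Definition SU (n : nat) (H : 'M[C]_n) : set 'M[C]_n :=
  [set A | \det A = 1 /\ A^t* *m H *m A = H].

(* Some basis (the columns of P) is orthogonal for w^* H z, with r vectors of
   square 1 and s vectors of square -1. *)
Definition has_signature (r s : nat) (H : 'M[C]_(r + s)) : Prop :=
  exists2 P : 'M[C]_(r + s), P \in unitmx &
    P^t* *m H *m P = block_mx 1%:M 0 0 (- 1%:M).

(* The subspace topology of [G], inherited from 'M[C]_n, is discrete; passing
   through the subspace topology of [K] makes no difference. *)
Definition discrete_subgroup (n : nat) (K G : set 'M[C]_n) : Prop :=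
  [/\ is_subgroup G, G `<=` K & forall A, G A -> isolated G A].

Lemma generated_group_subgroup n (S : set 'M[C]_n) :
  S `<=` [set A | A \in unitmx] -> is_subgroup (generated_group S).
Proof.
move=> unitS; split.
- apply: smallest_sub => //; split => //=.
  + by rewrite unitmx1.
  + by move=> A B /= uA uB; rewrite unitmx_mul uA.
  + by move=> A /=; rewrite unitmx_inv.
- by move=> G [[]].
- move=> A B GA GB G [sG SG]; have [_ _ m _] := sG.
  by apply: m; [exact: GA|exact: GB].
- move=> A GA G [sG SG]; have [_ _ _ i] := sG.
  by apply: i; exact: GA.
Qed.

Lemma SU_subgroup n (H : 'M[C]_n) : is_subgroup (SU H).
Proof.
have U A : SU H A -> A \in unitmx by case=> dA _; rewrite unitmxE dA unitr1.
split.
- exact: U.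
- by rewrite /SU /= det1 trmx1 map_mx1 mul1mx mulmx1.
- move=> A B [dA hA] [dB hB]; split; first by rewrite det_mulmx dA dB mulr1.
  by rewrite trmx_mul map_mxM -[RHS]hB -[in RHS]hA !mulmxA.
- move=> A [dA hA]; have uA : A \in unitmx by rewrite unitmxE dA unitr1.
  split; first by rewrite det_inv dA invr1.
  rewrite -[in LHS]hA -!mulmxA mulmxV // mulmx1 !mulmxA.
  by rewrite -map_mxM -trmx_mul mulmxV // trmx1 map_mx1 mul1mx.
Qed.
End HermitianGroups.

Section SporadicGroups.
Variable R : realType.
Local Open Scope complex_scope.

Definition expi (x : R) : R[i] := cos x +i* sin x.

Definition mx3 (rows : seq (seq R[i])) : 'M[R[i]]_3 :=
  \matrix_(i < 3, j < 3) nth 0 (nth [::] rows i) j.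

Definition psi (p : nat) : R := 2 * pi / p%:R.

Definition J : 'M[R[i]]_3 :=
  mx3 [:: [:: 0; 0; 1];
          [:: 1; 0; 0];
          [:: 0; 1; 0]].

Definition R1 (p : nat) (tau : R[i]) : 'M[R[i]]_3 :=
  mx3 [:: [:: expi (2 * psi p / 3); tau; - expi (psi p / 3) * tau^*];
          [:: 0; expi (- psi p / 3); 0];
          [:: 0; 0; expi (- psi p / 3)]].

Definition Hform (p : nat) (tau : R[i]) : 'M[R[i]]_3 :=
  let d := (2 * sin (psi p / 2))%:C in
  let a := - 'i * expi (- psi p / 6) * tau in
  let b := 'i * expi (psi p / 6) * tau^* in
  mx3 [:: [:: d; a; b];
          [:: b; d; a];
          [:: a; b; d]].

Definition Gamma (p : nat) (tau : R[i]) : set 'M[R[i]]_3 :=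
  generated_group [set R1 p tau; J].

Definition sigmas : seq R[i] := [::
  expi (pi / 3) + expi (- pi / 6) * (2 * cos (pi / 4))%:C;
  expi (pi / 3) + expi (- pi / 6) * (2 * cos (pi / 5))%:C;
  expi (pi / 3) + expi (- pi / 6) * (2 * cos (2 * pi / 5))%:C;
  expi (2 * pi / 7) + expi (4 * pi / 7) + expi (8 * pi / 7);
  expi (2 * pi / 9) + expi (- pi / 9) * (2 * cos (2 * pi / 5))%:C;
  expi (2 * pi / 9) + expi (- pi / 9) * (2 * cos (4 * pi / 5))%:C;
  expi (2 * pi / 9) + expi (- pi / 9) * (2 * cos (2 * pi / 7))%:C;
  expi (2 * pi / 9) + expi (- pi / 9) * (2 * cos (4 * pi / 7))%:C;
  expi (2 * pi / 9) + expi (- pi / 9) * (2 * cos (6 * pi / 7))%:C ].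

Definition sporadic_value (tau : R[i]) : Prop :=
  exists2 s, s \in sigmas & tau = s \/ tau = s^*.

(* The pair (p, tau) defines a sporadic triangle group. *)
Definition sporadic_pair (p : nat) (tau : R[i]) : Prop :=
  [/\ (2 <= p)%N, sporadic_value tau & @has_signature _ 2 1 (Hform p tau)].

Lemma expiD (x y : R) : expi (x + y) = expi x * expi y.
Proof.
rewrite /expi cosD sinD; simpc.
by rewrite [X in _ +i* X]addrC [sin x * _]mulrC [sin y * _]mulrC.
Qed.

Lemma expi0 : expi (0 : R) = 1.
Proof. by rewrite /expi cos0 sin0. Qed.

Lemma expiMn (x : R) n : expi (n%:R * x) = expi x ^+ n.
Proof.
elim: n => [|n IH]; first by rewrite mul0r expi0 expr0.
by rewrite -natr1 mulrDl mul1r expiD IH exprSr.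
Qed.

Lemma expi_conj (x : R) : (expi x)^* = expi (- x).
Proof. by rewrite /expi cosN sinN. Qed.

Lemma Hform_hermitian p (tau : R[i]) : (Hform p tau)^t* = Hform p tau.
Proof.
have Cd (x : R) : (x%:C)^*%R = x%:C :> R[i]
  by apply/eqP; rewrite eq_complex /= oppr0 !eqxx.
have Cab : (- 'i * expi (- psi p / 6) * tau)^*%R
           = 'i * expi (psi p / 6) * tau^* :> R[i].
  rewrite !rmorphM /=; congr (_ * _ * _).
    by apply/eqP; rewrite eq_complex /= oppr0 opprK !eqxx.
  by rewrite [LHS]expi_conj mulNr opprK.
have Cba : ('i * expi (psi p / 6) * tau^*)^*%R
           = - 'i * expi (- psi p / 6) * tau :> R[i].
  by rewrite -Cab conjCK.
apply/matrixP => i j; rewrite !mxE /=.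
case: i => -[|[|[|//]]] ?; case: j => -[|[|[|//]]] ? /=;
by rewrite ?Cd ?Cab ?Cba.
Qed.

Lemma mulmx3E (A B : 'M[R[i]]_3) i j :
  (A *m B) i j = A i 0 * B 0 j + A i 1 * B 1 j + A i (2%:R) * B (2%:R) j.
Proof.
rewrite mxE 3!big_ord_recl big_ord0 addr0 addrA.
by congr (_ + _ + _); congr (A _ _ * B _ _); apply/val_inj.
Qed.

Lemma det2E (A : 'M[R[i]]_2) : \det A = A 0 0 * A 1 1 - A 0 1 * A 1 0.
Proof.
rewrite (expand_det_row _ 0) !big_ord_recl big_ord0 /cofactor !det_mx11 !mxE.
have l00 : lift 0 0 = 1 :> 'I_2 by apply/val_inj.
have l10 : lift 1 0 = 0 :> 'I_2 by apply/val_inj.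
by rewrite !l00 !l10 /= /bump /=; ring.
Qed.

Lemma det3E (A : 'M[R[i]]_3) : \det A =
  A 0 0 * (A 1 1 * A 2%:R 2%:R - A 1 2%:R * A 2%:R 1)
  - A 0 1 * (A 1 0 * A 2%:R 2%:R - A 1 2%:R * A 2%:R 0)
  + A 0 2%:R * (A 1 0 * A 2%:R 1 - A 1 1 * A 2%:R 0).
Proof.
pose f (i j : nat) := A (inord i) (inord j).
have fE i j : A i j = f i j by rewrite /f !inord_val.
rewrite (expand_det_row _ 0) !big_ord_recl big_ord0 /cofactor.
rewrite !det2E !mxE !fE /= /bump /=; ring.
Qed.

Lemma J_SU p (tau : R[i]) : SU (Hform p tau) J.
Proof.
split.
  by rewrite det3E !mxE /=; ring.
apply/matrixP => i j; rewrite !mulmx3E !mxE /=.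
case: i => -[|[|[|//]]] ?; case: j => -[|[|[|//]]] ? /=;
rewrite ?rmorph0 ?rmorph1; ring.
Qed.

Lemma R1_SU p (tau : R[i]) : SU (Hform p tau) (R1 p tau).
Proof.
set x := psi p / 6.
have E1 : expi (2 * psi p / 3) = expi x ^+ 4
  by rewrite -expiMn; congr expi; rewrite /x; field.
have E2 : expi (psi p / 3) = expi x ^+ 2
  by rewrite -expiMn; congr expi; rewrite /x; field.
have E3 : expi (- psi p / 3) = expi (- x) ^+ 2
  by rewrite -expiMn; congr expi; rewrite /x; field.
have E6 : expi (- psi p / 6) = expi (- x) by congr expi; rewrite /x mulNr.
have Ed : (2 * sin (psi p / 2))%:C = - 'i * (expi x ^+ 3 - expi (- x) ^+ 3).
  rewrite -!expiMn mulrN.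
  have -> : 3 * x = psi p / 2 by rewrite /x; field.
  rewrite /expi cosN sinN; simpc; rewrite /=; congr (_ +i* _); ring.
have Ev : expi x != 0.
  apply/eqP => e; have := expiD x (- x).
  by rewrite subrr expi0 e mul0r => /eqP; rewrite oner_eq0.
have EN : expi (- x) = (expi x)^-1.
  by apply: (mulfI Ev); rewrite -expiD subrr expi0 divff.
have Cu : (expi x)^*%R = (expi x)^-1 by rewrite -EN -expi_conj.
rewrite /Hform /R1 Ed E1 E2 E3 E6 -/x EN.
set u := expi x in Ev Cu *.
split.
  by rewrite det3E !mxE /=; field.
apply/matrixP => i j; rewrite !mulmx3E !mxE /=.
have Ct : (tau^*)%R = tau^*%C by [].
have Ctt : (tau^*)^*%R = tau by exact: (@conjCK _ tau).
have C0 : Num.conj (0 : R[i]) = 0 by rewrite rmorph0.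
have Cr : (- u ^+ 2 * tau^*)^*%R = - (u ^- 2) * tau.
  by rewrite rmorphM rmorphN rmorphXn /= Cu exprVn; congr (_ * _).
have C4 : (u ^+ 4)^*%R = u ^- 4 by rewrite rmorphXn /= Cu exprVn.
have C2 : (u ^-1 ^+ 2)^*%R = u ^+ 2 by rewrite rmorphXn fmorphV /= Cu invrK.
case: i => -[|[|[|//]]] ?; case: j => -[|[|[|//]]] ? /=;
rewrite ?C0 ?Cr ?C4 ?C2 ?Ct; field; done.
Qed.

Lemma Gamma_subgroup p (tau : R[i]) :
  is_subgroup (Gamma p tau) /\ Gamma p tau `<=` SU (Hform p tau).
Proof.
have S : [set R1 p tau; J] `<=` SU (Hform p tau).
  by move=> A [->|->]; [exact: R1_SU|exact: J_SU].
split; last exact: smallest_sub (SU_subgroup _) S.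
apply: generated_group_subgroup => A /S.
by have [+ _ _ _] := SU_subgroup (Hform p tau); apply.
Qed.
End SporadicGroups.

(* Main.v *)
Require Import Defs.
From mathcomp Require Import all_boot all_order all_algebra complex ring lra.
From mathcomp Require Import boolp classical_sets cardinality.
From mathcomp Require Import reals topology normedtype function_spaces trigo.

Set Implicit Arguments.
Unset Strict Implicit.
Unset Printing Implicit Defensive.

Import Order.TTheory GRing.Theory Num.Theory.
Import numFieldNormedType.Exports.

Local Open Scope classical_set_scope.
Local Open Scope ring_scope.
Local Open Scope sesquilinear_scope.

(* For every sporadic [tau] one has [|tau|^2 = 2 - z - 1/z] with [z] a root of
   unity of order 3, 4, 5 or 7.  Put [u = e^(i psi)] and [R2 = J R1 J^-1].  On
   the span of e1 and e2 the product [R1 R2] has, up to a common scalar, the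
   eigenvalues [u z] and [u / z], and 1 on the orthogonal line, so
   [M = (R1 R2)^420] is, up to a scalar of modulus 1, a complex reflection of
   multiplier [mu = u^-420] whose polar vector [n] is orthogonal to e1 and e2.
   As [p] grows, [mu] tends to 1 without being 1.

   A Jorgensen-type argument then applies to [M] and [J].  Let [B_0 = J M J^-1]
   and [B_(k+1) = B_k M B_k^-1]; these are the reflections with polar vectors
   [x_k], and [t_k = <x_k, n> / <n, n>] satisfies
   [|t_(k+1)|^2 - 1 = |mu - 1|^2 |t_k|^2 (|t_k|^2 - 1)].  If [|t_0| > 1] and
   [mu] is close to 1, then [|t_k|] decreases strictly to 1 and [B_k] converges to
   [M] without ever being equal to it, so the group is not discrete.  The
   inequality [|t_0| > 1] amounts to [det H < 0], which is what signature (2,1)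
   provides. *)

(** * Complex reflections for a Hermitian form *)

Section ComplexReflections.
Variables (C : numClosedFieldType) (m : nat).
Implicit Types (H B : 'M[C]_m) (x y : 'cV[C]_m) (c : C).

Definition herm H x y : C := (y^t* *m H *m x) 0 0.

(* With [c = (mu - 1) / herm H x x] this is the complex reflection of
   multiplier [mu] and polar vector [x]. *)
Definition reflection H c x : 'M[C]_m := 1%:M + c *: (x *m x^t* *m H).

Lemma hermDl H x1 x2 y : herm H (x1 + x2) y = herm H x1 y + herm H x2 y.
Proof. by rewrite /herm mulmxDr mxE. Qed.

Lemma hermZl H a x y : herm H (a *: x) y = a * herm H x y.
Proof. by rewrite /herm -scalemxAr mxE. Qed.

Lemma hermC H x y : H^t* = H -> (herm H x y)^* = herm H y x.
Proof.
move=> hH; rewrite /herm -[in RHS]hH.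
have -> : x^t* *m H^t* *m y = (y^t* *m H *m x)^t*.
  rewrite !trmx_mul !map_mxM mulmxA; congr (_ *m _ *m _).
  by apply/matrixP=> i j; rewrite !mxE; exact/esym/conjCK.
by rewrite !mxE.
Qed.

Lemma reflection_mulmx H c x y :
  reflection H c x *m y = y + (c * herm H y x) *: x.
Proof.
rewrite mulmxDl mul1mx -scalemxAl -scalerA; congr (_ + _ *: _).
rewrite -!mulmxA (mulmxA _ H) [_ *m y]mx11_scalar -/(herm H y x).
by rewrite mul_mx_scalar.
Qed.

(** The scalar cancels in [x *m x^t*]. This absorbs the unimodular factors brought in by conjugation
    and by the limit vector [mu *: n]. *)
Lemma reflectionZ H c a x :
  a * a^* = 1 -> reflection H c (a *: x) = reflection H c x.
Proof.
move=> a1; rewrite /reflection; congr (_ + _ *: (_ *m _)).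
have -> : (a *: x)^t* = a^* *: x^t*.
  by apply/matrixP => i j; rewrite !mxE rmorphM.
by rewrite -scalemxAl -scalemxAr scalerA a1 scale1r.
Qed.

Lemma conjugate_reflection H c x B : B \in unitmx -> B^t* *m H *m B = H ->
  B *m reflection H c x *m invmx B = reflection H c (B *m x).
Proof.
move=> uB hB; rewrite mulmxDr mulmxDl mulmx1 mulmxV //; congr (_ + _).
rewrite -scalemxAr -scalemxAl; congr (_ *: _).
rewrite trmx_mul map_mxM -[in LHS]hB -!mulmxA; congr (_ *m (_ *m (_ *m _))).
by rewrite mulmxA mulmxV // mulmx1.
Qed.

End ComplexReflections.

(** * The Jorgensen sequence: recurrences and rate of convergence *)

Section JorgensenSequence.
Variables (C : numClosedFieldType) (m : nat) (H W : 'M[C]_m) (n : 'cV[C]_m).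
Variables (mu : C).
Hypothesis hermH : H^t* = H.
Hypothesis n_neq0 : herm H n n != 0.
Let h := herm H n n.
Let c := (mu - 1) / h.

(** The coefficient is [c * herm H n x] rewritten by Hermitian symmetry, so that each vector is the
    image of [n] under the reflection at the previous one. *)
Fixpoint orbit_vec k : 'cV[C]_m :=
  if k is k'.+1 then
    let x := orbit_vec k' in n + ((mu - 1) * (herm H x n / h)^*) *: x
  else W *m n.

Let t k := herm H (orbit_vec k) n / h.

Lemma orbit_vecS k : reflection H c (orbit_vec k) *m n = orbit_vec k.+1.
Proof.
rewrite reflection_mulmx /= /c -/h; congr (_ + _ *: _).
have hr : h^* = h by exact: hermC.
rewrite -(hermC (orbit_vec k) n hermH) [in RHS]rmorphM fmorphV /= -/h hr.
by rewrite mulrAC mulrA.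
Qed.

Lemma orbit_coefS k : t k.+1 = 1 + (mu - 1) * (t k * (t k)^*).
Proof.
rewrite /t /= hermDl hermZl -/h mulrDl divff //; congr (_ + _).
by rewrite -!mulrA; congr (_ * _); rewrite [RHS]mulrA [RHS]mulrC.
Qed.

Hypothesis mu1 : mu * mu^* = 1.
Hypothesis mu_near1 : `|mu - 1| <= 8^-1.
Hypothesis mu_neq1 : mu != 1.
Hypothesis t0_gt1 : 1 < `|t 0|.
Hypothesis t0_le2 : `|t 0| <= 2.

Let s k := t k * (t k)^* - 1.

(** Expand the square of [1 + (mu - 1) * |t k|^2]: since [|mu| = 1], the linear coefficient
    [mu + mu^* - 2] equals [- |mu - 1|^2]. *)
Lemma orbit_excessS k : s k.+1 = `|mu - 1| ^+ 2 * (1 + s k) * s k.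
Proof.
rewrite /s orbit_coefS normCK; move: (t k) => x.
rewrite !(rmorphD, rmorphM, rmorphN, rmorph1) /= [x^*^*]conjCK.
move: mu1; set mub := mu^*; set y := x^* => e.
ring: e.
Qed.

(** The excess starts at most at [2^2 - 1 = 3] and stays there, so the factor in the recurrence is
    at most [8^-1 * 4 = 1/2]; it is positive because [mu != 1]. *)
Lemma orbit_excess_bound k : 0 < s k <= 3 / 2 ^+ k.
Proof.
elim: k => [|k /andP[s0 sk]].
  rewrite /s -normCK expr0 divr1 lerBlDr subr_gt0 exprn_egt1 //=.
  have -> : 3 + 1 = 2 ^+ 2 :> C by ring.
  by rewrite ler_pXn2r ?nnegrE.
have b0 : 0 < `|mu - 1| by rewrite normr_gt0 subr_eq0.
have sp : 0 < 1 + s k by rewrite addr_gt0.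
rewrite orbit_excessS !mulr_gt0 ?exprn_gt0 //=.
have s4 : 1 + s k <= 4.
  have : s k <= 3.
    apply: (le_trans sk); rewrite ler_pdivrMr ?exprn_gt0 // ler_peMr //.
    by rewrite exprn_ege1 // ler1n.
  have -> : 4 = 1 + 3 :> C by ring.
  by rewrite lerD2l.
have bb : `|mu - 1| ^+ 2 <= 8^-1.
  rewrite -[leRHS]mulr1 expr2 ler_pM // (le_trans mu_near1) //.
  by rewrite invf_le1 // ler1n.
have : `|mu - 1| ^+ 2 * (1 + s k) <= 8^-1 * 4.
  by apply: ler_pM => //; rewrite ?exprn_ge0 // ltW.
have -> : 8^-1 * 4 = 2^-1 :> C by field.
move=> le2; rewrite [in leRHS]exprS invfM mulrCA.
by apply: ler_pM => //; [rewrite mulr_ge0 ?exprn_ge0 // ltW | exact: ltW].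
Qed.

Lemma orbit_coef_le2 k : `|t k| <= 2.
Proof.
have /andP[_ sk] := orbit_excess_bound k.
rewrite -(@ler_pXn2r _ 2) ?nnegrE // normCK -(lerD2r (- 1)).
apply: (le_trans sk); have -> : 2 ^+ 2 + -1 = 3 :> C by ring.
by rewrite ler_pdivrMr ?exprn_gt0 // ler_peMr // exprn_ege1 // ler1n.
Qed.

Lemma normr_mu : `|mu| = 1.
Proof. by apply/eqP; rewrite -(@pexpr_eq1 _ _ 2) // normCK mu1. Qed.

Lemma orbit_coef_dist k : `|t k - mu| <= 3 / 2 ^+ k.
Proof.
case: k => [|k].
  rewrite expr0 divr1 (le_trans (ler_normB _ _)) // normr_mu.
  have -> : 3 = 2 + 1 :> C by ring.
  by rewrite lerD2r.
have /andP[s0 sk] := orbit_excess_bound k.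
have -> : t k.+1 - mu = (mu - 1) * s k by rewrite orbit_coefS /s; ring.
rewrite normrM (gtr0_norm s0) exprS invfM mulrCA.
apply: ler_pM => //; first exact: ltW.
by rewrite (le_trans mu_near1) // lef_pV2 ?posrE // ler_nat.
Qed.

(** At the limit value [t = mu] the recurrence reads [x = n + (mu - 1) mu^* x], with fixed point
    [mu *: n] because [mu * mu^* = 1]. *)
Lemma orbit_vec_dist i : exists K : C,
  forall k, `|orbit_vec k i 0 - mu * n i 0| <= K / 2 ^+ k.
Proof.
pose K0 := `|orbit_vec 0 i 0 - mu * n i 0|.
(* This [K] gives [3 * |n i 0| + 2 * K <= 4 * K], which the factor [|mu - 1| <= 1/8] reduces to
   [K / 2]. *)
pose K := K0 + 2 * `|n i 0|.
have K0_ge0 : 0 <= K0 by exact: normr_ge0.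
exists K; elim=> [|k IH]; first by rewrite expr0 divr1 lerDl mulr_ge0.
set e := _ - _ in IH.
have -> : orbit_vec k.+1 i 0 - mu * n i 0 =
    (mu - 1) * (mu * (t k - mu)^* * n i 0) + (mu - 1) * ((t k)^* * e).
  rewrite [orbit_vec k.+1]/= !mxE -/(t k) /e rmorphB /=.
  move: mu1; set mub := mu^*; set tb := (t k)^* => mu1'.
  ring: mu1'.
have p0 : 0 < 2 ^+ k :> C by rewrite exprn_gt0.
have b1 : `|mu * (t k - mu)^* * n i 0| <= 3 / 2 ^+ k * `|n i 0|.
  rewrite !normrM normr_mu mul1r norm_conjC.
  by apply: ler_pM => //; exact: orbit_coef_dist.
have b2 : `|(t k)^* * e| <= 2 * (K / 2 ^+ k).
  rewrite normrM norm_conjC; apply: ler_pM => //; exact: orbit_coef_le2.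
have b3 : `|mu * (t k - mu)^* * n i 0| + `|(t k)^* * e| <= 4 * K / 2 ^+ k.
  apply: (le_trans (lerD b1 b2)).
  rewrite [leLHS](_ : _ = (3 * `|n i 0| + 2 * K) / 2 ^+ k); last by ring.
  rewrite ler_pM2r ?invr_gt0 //.
  have -> : 4 * K = (4 * `|n i 0| + 2 * K0) + 2 * K by rewrite /K; ring.
  rewrite lerD2r.
  have -> : 4 * `|n i 0| + 2 * K0 = 3 * `|n i 0| + (`|n i 0| + 2 * K0) by ring.
  by rewrite lerDl addr_ge0 // mulr_ge0.
apply: (le_trans (ler_normD _ _)); rewrite ![`|(mu - 1) * _|]normrM -mulrDr.
have -> : K / 2 ^+ k.+1 = 8^-1 * (4 * K / 2 ^+ k) by rewrite exprS; field; rewrite gt_eqF.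
by apply: ler_pM => //; rewrite addr_ge0.
Qed.

(** Apply both sides to [n] and pair with [n]: equality would force [t k.+1 = mu], hence
    [(mu - 1) * s k = 0], against the positivity of the excess. *)
Lemma orbit_reflection_neq k :
  reflection H c (orbit_vec k) != reflection H c n.
Proof.
apply/eqP => /(congr1 (fun A => herm H (A *m n) n)).
rewrite orbit_vecS reflection_mulmx hermDl hermZl -/h.
have -> : herm H (orbit_vec k.+1) n = t k.+1 * h by rewrite /t -/h divfK.
have -> : h + c * h * h = mu * h by rewrite /c; field.
move/(mulIf n_neq0); rewrite orbit_coefS => e.
have : (mu - 1) * s k = 0.
  by apply/eqP; rewrite mulrBr mulr1 subr_eq0 -(inj_eq (addrI 1)) e addrC subrK.
move/eqP; rewrite mulf_eq0 subr_eq0 (negPf mu_neq1) /= => /eqP s0.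
by have /andP[] := orbit_excess_bound k; rewrite s0 ltxx.
Qed.

End JorgensenSequence.

(** * Conjugates accumulating at a reflection *)

Section NonDiscreteness.
Variable C : numClosedFieldType.
Hypothesis archiC : forall x : C, 0 <= x -> exists k : nat, x < k%:R.

(** The Archimedean hypothesis makes [2 ^+ k] outgrow [K / e]. *)
Lemma cvg_geometric_bound (u : nat -> C) (l K : C) :
  (forall k, `|u k - l| <= K / 2 ^+ k) -> u @ \oo --> l.
Proof.
move=> uK; apply/cvgrPdist_lt => e e0.
have K0 : 0 <= K by have := uK 0; rewrite expr0 divr1; apply: le_trans.
have [N KN] := archiC (divr_ge0 K0 (ltW e0)).
exists N => // k /= Nk.
rewrite distrC (le_lt_trans (uK k)) // ltr_pdivrMr ?exprn_gt0 //.
rewrite mulrC -ltr_pdivrMr // (lt_le_trans KN) // -natrX ler_nat.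
exact: leq_trans Nk (ltnW (ltn_expl k (ltnSn 1))).
Qed.

Lemma not_isolated_reflection m (H : 'M[C]_m) (G : set 'M[C]_m)
    (n : 'cV[C]_m) (mu lam : C) (W : 'M[C]_m) :
  let h := herm H n n in
  let M := lam *: reflection H ((mu - 1) / h) n in
  H^t* = H -> h != 0 -> mu * (mu^*)%R = 1 -> lam * (lam^*)%R = 1 ->
  `|mu - 1| <= 8^-1 -> mu != 1 ->
  1 < `|herm H (W *m n) n / h| -> `|herm H (W *m n) n / h| <= 2 ->
  is_subgroup G -> G `<=` SU H -> G M -> G W -> ~ isolated G M.
Proof.
move=> h M hH h0 mu1 lam1 mu8 mu_neq1 t1 t2 [unitG _ mulG invG] GS GM GW.
have lam0 : lam != 0.
  by apply: contra_eq_neq lam1 => ->; rewrite mul0r eq_sym oner_neq0.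
pose x := orbit_vec H W n mu; set c := (mu - 1) / h in M GM *.
pose B k := lam *: reflection H c (x k).
have conjM A : G A -> A *m M *m invmx A = lam *: reflection H c (A *m n).
  move=> GA; have [_ hA] := GS _ GA.
  rewrite -scalemxAr -scalemxAl conjugate_reflection //; exact: unitG.
have GB k : G (B k).
  elim: k => [|k IH].
    rewrite /B -conjM //; exact: (mulG _ _ (mulG _ _ GW GM) (invG _ GW)).
  have : G (B k *m M *m invmx (B k)).
    exact: (mulG _ _ (mulG _ _ IH GM) (invG _ IH)).
  (* The factor [lam] of [B k] only multiplies the new polar vector by a unimodular scalar. *)
  by rewrite conjM // -scalemxAl orbit_vecS // reflectionZ.
have BM k : B k != M.
  apply/eqP => /(scalerI lam0)/eqP; apply/negP; exact: orbit_reflection_neq.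
have xl i : (fun k => x k i 0) @ \oo --> mu * n i 0.
  have [K xK] := orbit_vec_dist h0 mu1 mu8 mu_neq1 t1 t2 i.
  exact: cvg_geometric_bound xK.
have xcl i : (fun k => (x k i 0)^*)%R @ \oo --> ((mu * n i 0)^*)%R.
  have [K xK] := orbit_vec_dist h0 mu1 mu8 mu_neq1 t1 t2 i.
  apply: (@cvg_geometric_bound _ _ K) => k.
  by rewrite -rmorphB norm_conjC; exact: xK.
have Bl i j : (fun k => B k i j) @ \oo --> M i j.
  have E lam' y : (lam' *: reflection H c y) i j = lam' *
     ((1%:M : 'M[C]_m) i j + c * \sum_l y i 0 * (y l 0)^* * H l j).
    rewrite !mxE; congr (_ * (_ + _ * _)); apply: eq_bigr => l _.
    by rewrite !mxE big_ord1 !mxE.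
  rewrite /B; under eq_fun do rewrite E.
  (* The polar vectors tend to [mu *: n], whose reflection is that of [n]. *)
  rewrite /M -[reflection H c n](@reflectionZ _ _ _ _ mu) // E.
  apply: cvgMl_tmp; apply: cvgD; first exact: cvg_cst.
  apply: cvgMl_tmp; apply: cvg_big => [|l _]; first exact: add_continuous.
  apply: cvgMr_tmp; rewrite !mxE.
  by apply: cvgM.
(* A neighbourhood of [M] is controlled entrywise by [P], so it contains some [B k], a point of [G]
   other than [M]. *)
case=> _ [V [P nP PV] VG].
have : \forall k \near \oo, forall i j, P i j (B k i j).
  apply: filter_forall => i; apply: filter_forall => j.
  exact: Bl (nP i j).
case=> k _ /(_ k (leqnn k)) Pk.
have : (V `&` G) (B k) by split => //; apply: PV.
by rewrite VG => /eqP; apply/negP; exact: BM.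
Qed.

End NonDiscreteness.

(** * Powers of a product of two reflections *)

Lemma sum_ord3 (V : nmodType) (f : 'I_3 -> V) :
  \sum_i f i = f 0 + f 1 + f 2%:R.
Proof.
rewrite 3!big_ord_recl big_ord0 addr0 addrA.
by congr (f _ + f _ + f _); apply/val_inj.
Qed.

(** The product [(X - x)(X - y)] kills [Y], so [(x - y) *: Y] is the difference of [X * Y - y *: Y]
    and [X * Y - x *: Y], whose columns [X] scales by [x] and by [y]; both scalars have [N]-th power
    [g]. *)
Lemma two_eigenvalues_expr (F : fieldType) m (X Y : 'M[F]_m.+1) (x y g : F) N :
  X * (X * Y) - (x + y) *: (X * Y) + (x * y) *: Y = 0 ->
  x != y -> x ^+ N = g -> y ^+ N = g -> X ^+ N * Y = g *: Y.
Proof.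
have eigen z (V : 'M[F]_m.+1) : X * V = z *: V -> X ^+ N * V = z ^+ N *: V.
  move=> XV; elim: N => [|k IH]; first by rewrite !expr0 mul1r scale1r.
  by rewrite exprS -mulrA IH -scalerAr XV scalerA -exprSr.
move=> XY xy xN yN.
have sub z : X ^+ N * (X * Y - z *: Y) = X ^+ N * (X * Y) - z *: (X ^+ N * Y).
  by rewrite mulrBr -scalerAr.
have ex : X * (X * Y - y *: Y) = x *: (X * Y - y *: Y).
  apply/eqP; rewrite -subr_eq0 -[X in _ == X]XY mulrBr -scalerAr scalerBr.
  by rewrite scalerA scalerDl !opprD opprK !addrA [_ - _ - _]addrAC.
have ey : X * (X * Y - x *: Y) = y *: (X * Y - x *: Y).
  apply/eqP; rewrite -subr_eq0 -[X in _ == X]XY mulrBr -scalerAr scalerBr.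
  by rewrite scalerA scalerDl !opprD opprK !addrA [y * x]mulrC.
have xy0 : x - y != 0 by rewrite subr_eq0.
apply: (scalerI xy0).
have dif (A B : 'M[F]_m.+1) : (x - y) *: A = (B - y *: A) - (B - x *: A).
  by rewrite scalerBl opprB [RHS]addrC addrA subrK.
rewrite (dif _ (X ^+ N * (X * Y))) -!sub (eigen _ _ ex) (eigen _ _ ey) xN yN.
by rewrite -scalerBr -dif !scalerA mulrC.
Qed.

Section PairOfReflections.
Variable R : realType.
Local Notation C := R[i].
Implicit Types a b d k g z w : C.

Definition circulant d a b : 'M[C]_3 :=
  mx3 [:: [:: d; a; b]; [:: b; d; a]; [:: a; b; d]].

(* The product [A1 A2] of the complex reflections [A1 = 1 + k e1 e1^* H] and
   [A2 = 1 + k e2 e2^* H], where [H = circulant d a b]. *)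
Definition reflection_pair k d a b : 'M[C]_3 :=
  mx3 [:: [:: 1 + k * d + k ^+ 2 * (a * b); k * a * (1 + k * d);
              k ^+ 2 * a ^+ 2 + k * b];
          [:: k * b; 1 + k * d; k * a];
          [:: 0; 0; 1]].

Lemma det_circulant d a b :
  \det (circulant d a b) = d ^+ 3 - 3 * d * (a * b) + a ^+ 3 + b ^+ 3.
Proof. by rewrite det3E !mxE /=; ring. Qed.

(** The columns of [X - 1] lie in the span of e1 and e2, where [X] has trace
    [u * (2 - a * b) = u * (z + w)] and determinant [u ^+ 2]: this is Cayley-Hamilton on that
    plane. *)
Lemma reflection_pair_poly k d a b z w :
  k * d = - k ^+ 2 - 1 -> z * w = 1 -> a * b = 2 - z - w ->
  let X := reflection_pair k d a b in let u := 1 + k * d in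
  X * (X * (X - 1)) - (u * z + u * w) *: (X * (X - 1))
    + (u * z * (u * w)) *: (X - 1) = 0.
Proof.
move=> kd zw ab X u.
apply/matrixP => i j; rewrite -!mulmxE !(mulmx3E, mxE) /= /u.
case: i => -[|[|[|//]]] ?; case: j => -[|[|[|//]]] ? /=; ring: kd zw ab.
Qed.

(* Third column of the adjugate of [circulant d a b], hence orthogonal to e1
   and e2 for the form. *)
Definition polar_vec d a b : 'cV[C]_3 :=
  \col_i nth 0 [:: a ^+ 2 - d * b; b ^+ 2 - d * a; d ^+ 2 - a * b] i.

Lemma polar_vec_conj_circulant d a b : d^* = d -> a^* = b ->
  (polar_vec d a b)^t* *m circulant d a b =
    \det (circulant d a b) *: delta_mx 0 2%:R.
Proof.
move=> dR ab; have ba : b^* = a by rewrite -ab conjCK.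
apply/matrixP => i j; rewrite mxE sum_ord3 !mxE /=.
rewrite det_circulant !(rmorphB, rmorphM, rmorphXn) /= dR ab ba.
rewrite ord1; case: j => -[|[|[|//]]] ? /=; ring.
Qed.

Lemma herm_polar_vec d a b x : d^* = d -> a^* = b ->
  herm (circulant d a b) x (polar_vec d a b) =
    \det (circulant d a b) * x 2%:R 0.
Proof.
move=> dR ab; rewrite /herm polar_vec_conj_circulant // -scalemxAl mxE.
by rewrite -rowE mxE.
Qed.

(** The matrix [Z = X ^+ N - g] satisfies [(X - 1) * Z = 0], so its columns are orthogonal to e1 and
    e2, hence multiples of the polar vector. The last row of [Z], known because that of [X] is
    trivial, fixes the multiples. *)
Lemma reflection_pair_expr k d a b z w N :
  k != 0 -> k * d = - k ^+ 2 - 1 -> z * w = 1 -> a * b = 2 - z - w ->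
  d^* = d -> a^* = b -> z != w -> z ^+ N = 1 ->
  a * b != d ^+ 2 -> \det (circulant d a b) != 0 ->
  let H := circulant d a b in let n := polar_vec d a b in
  let g := (1 + k * d) ^+ N in
  reflection_pair k d a b ^+ N = g *: reflection H ((g^-1 - 1) / herm H n n) n.
Proof.
move=> k0 kd zw ab dR conjab zDw zN n3 det0 H n g.
set X := reflection_pair k d a b.
have u0 : 1 + k * d != 0.
  have -> : 1 + k * d = - k ^+ 2 by rewrite kd; ring.
  by rewrite oppr_eq0 expf_neq0.
have wN : w ^+ N = 1.
  by rewrite -[w ^+ N]mul1r -{1}zN -exprMn zw expr1n.
have XY : (X - 1) * X ^+ N = g *: (X - 1).
  have -> : (X - 1) * X ^+ N = X ^+ N * (X - 1).
    by rewrite mulrBl mulrBr mul1r mulr1 -exprS -exprSr.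
  apply: (two_eigenvalues_expr (reflection_pair_poly kd zw ab)).
  - by rewrite (inj_eq (mulfI u0)).
  - by rewrite exprMn zN mulr1.
  - by rewrite exprMn wN mulr1.
have row3 j : (X ^+ N) 2%:R j = (2%:R == j)%:R.
  elim: N {zN wN XY g} => [|N IH]; first by rewrite expr0 mxE.
  by rewrite exprS -mulmxE mulmx3E !mxE /= IH; ring.
have g0 : g != 0 by rewrite expf_neq0.
have nz : d ^+ 2 - a * b != 0 by rewrite subr_eq0 eq_sym.
set Z := X ^+ N - g *: 1.
have XZ : (X - 1) * Z = 0.
  by rewrite mulrBr XY -scalerAr mulr1 subrr.
have Zcol j : Z 0 j * (d ^+ 2 - a * b) = (a ^+ 2 - d * b) * Z 2%:R j /\
              Z 1 j * (d ^+ 2 - a * b) = (b ^+ 2 - d * a) * Z 2%:R j.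
  have := congr1 (fun A : 'M_3 => A 0 j) XZ; have := congr1 (fun A : 'M_3 => A 1 j) XZ.
  rewrite -!mulmxE !mulmx3E; move: (Z 0 j) (Z 1 j) (Z 2%:R j) => z1 z2 z3.
  rewrite !mxE /= => e2 e1.
  have e2' : b * z1 + d * z2 + a * z3 = 0.
    by apply: (mulfI k0); rewrite mulr0 -e2; ring.
  have e1' : d * z1 + a * z2 + b * z3 = 0.
    apply: (mulfI k0); rewrite mulr0 -e1.
    (* The first row of [X - 1] is [k] times the first row of the form plus [k ^+ 2 * a] times the
       second, which [e2'] already kills. *)
    have -> : k * (d * z1 + a * z2 + b * z3) =
      k * (d * z1 + a * z2 + b * z3) + k ^+ 2 * a * (b * z1 + d * z2 + a * z3).
      by rewrite e2' mulr0 addr0.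
    by ring.
  split; apply/eqP; rewrite -subr_eq0; apply/eqP.
  - have -> : z1 * (d ^+ 2 - a * b) - (a ^+ 2 - d * b) * z3 =
      d * (d * z1 + a * z2 + b * z3) - a * (b * z1 + d * z2 + a * z3) by ring.
    by rewrite e1' e2' !mulr0 subr0.
  - have -> : z2 * (d ^+ 2 - a * b) - (b ^+ 2 - d * a) * z3 =
      d * (b * z1 + d * z2 + a * z3) - b * (d * z1 + a * z2 + b * z3) by ring.
    by rewrite e1' e2' !mulr0 subr0.
have -> : X ^+ N = g *: 1 + Z by rewrite addrC subrK.
rewrite /reflection scalerDr; congr (_ + _).
rewrite -[n *m _ *m _]mulmxA polar_vec_conj_circulant // herm_polar_vec //.
rewrite -/H -scalemxAr !scalerA.
have -> : g * ((g^-1 - 1) / (\det H * n 2%:R 0)) * \det H =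
    (1 - g) / (d ^+ 2 - a * b).
  by rewrite mxE /=; field; rewrite nz det0 g0.
apply/matrixP => i j.
have Z3 : Z 2%:R j = (2%:R == j)%:R * (1 - g).
  by rewrite mxE row3 !mxE; ring.
have [Z1 Z2] := Zcol j.
apply: (mulIf nz).
have e3 : (n *m delta_mx 0 (2%:R : 'I_3)) i j = n i 0 * (2%:R == j)%:R.
  by rewrite mxE big_ord1 [delta_mx _ _ _ _]mxE eqxx eq_sym.
rewrite [in RHS]mxE e3 mulrAC divfK // [n i 0]mxE.
case: i {e3} => -[|[|[|//]]] i3 /=.
- by rewrite [Ordinal i3](_ : _ = 0) ?Z1 ?Z3; [ring | exact/val_inj].
- by rewrite [Ordinal i3](_ : _ = 1) ?Z2 ?Z3; [ring | exact/val_inj].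
- by rewrite [Ordinal i3](_ : _ = 2%:R) ?Z3; [ring | exact/val_inj].
Qed.

End PairOfReflections.

(** * Non-discreteness of a single group *)

Section SporadicGroupPowers.
Variable R : realType.
Local Notation C := R[i].

Lemma det_signature21 (H : 'M[C]_3) : @has_signature C 2 1 H -> \det H < 0.
Proof.
case=> P uP /(congr1 determinant); rewrite !det_mulmx det_map_mx det_tr.
have -> : \det (block_mx (1%:M : 'M[C]_2) 0 0 (- 1%:M : 'M[C]_1)) = -1.
  by rewrite det_ublock det1 mul1r det_mx11 !mxE.
rewrite mulrAC [_^* * _]mulrC -normCK => e.
have P0 : 0 < `|\det P| ^+ 2.
  by rewrite exprn_gt0 // normr_gt0 -unitfE -unitmxE.
by rewrite -(pmulr_rlt0 _ P0) e ltrN10.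
Qed.

(** The lower bound is the identity [|n 1 0|^2 - |n 2 0|^2 = - d * \det H], for [H] the circulant
    form. For the upper one, [4 * d <= |a|] makes the numerator at most 5/4 and the denominator at
    least 15/16 of [|a|^2]. *)
Lemma polar_vec_ratio (d a b : C) : 0 < d -> a^* = b ->
  \det (circulant d a b) < 0 -> 4 * d <= `|a| ->
  let n := polar_vec d a b in
  [/\ d ^+ 2 - a * b != 0, 1 < `|n 1 0 / n 2%:R 0| & `|n 1 0 / n 2%:R 0| <= 2].
Proof.
move=> d0 ab det0 da n.
have dR : d^* = d by apply/CrealP/gtr0_real.
have ba : b^* = a by rewrite -ab conjCK.
have r2 : a * b = `|a| ^+ 2 by rewrite normCK ab.
set r := `|a| in r2 da.
have rb : `|b| = r by rewrite -ab norm_conjC.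
have r0 : 0 < r by apply: lt_le_trans da; rewrite mulr_gt0.
have d2 : 16 * d ^+ 2 <= r ^+ 2.
  have -> : 16 * d ^+ 2 = (4 * d) ^+ 2 by ring.
  by rewrite ler_pXn2r // nnegrE ?mulr_ge0 // ltW.
have n3 : r ^+ 2 * (15 / 16) <= r ^+ 2 - d ^+ 2.
  rewrite -subr_ge0.
  have -> : r ^+ 2 - d ^+ 2 - r ^+ 2 * (15 / 16) = (r ^+ 2 - 16 * d ^+ 2) / 16 by field.
  by rewrite divr_ge0 // subr_ge0.
have n3p : 0 < r ^+ 2 - d ^+ 2.
  by apply: lt_le_trans n3; rewrite mulr_gt0 ?exprn_gt0 ?divr_gt0.
have n3E : `|n 2%:R 0| = r ^+ 2 - d ^+ 2.
  by rewrite mxE /= r2 -opprB normrN gtr0_norm.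
have n2E : n 1 0 = b ^+ 2 - d * a by rewrite mxE.
have n3nz : d ^+ 2 - a * b != 0.
  by rewrite r2 -opprB oppr_eq0 gt_eqF.
rewrite normf_div n3E; split => //.
- rewrite ltr_pdivlMr // mul1r -(@ltr_pXn2r _ 2) ?nnegrE ?(ltW n3p) //.
  have n2c : (n 1 0)^* = a ^+ 2 - d * b.
    by rewrite n2E rmorphB !rmorphM /= dR ab ba.
  rewrite [`|n 1 0| ^+ 2]normCK n2c n2E -r2 -subr_gt0.
  move: det0; rewrite det_circulant.
  set D := _ + b ^+ 3 => D0.
  have -> : (b ^+ 2 - d * a) * (a ^+ 2 - d * b) - (a * b - d ^+ 2) ^+ 2 = - (d * D).
    by rewrite /D; ring.
  by rewrite oppr_gt0 pmulr_rlt0.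
- rewrite ler_pdivrMr // n2E.
  apply: (le_trans (ler_normB _ _)); rewrite normrX normrM rb (gtr0_norm d0) -/r.
  apply: (@le_trans _ _ (2 * (r ^+ 2 * (15 / 16)))); last by rewrite ler_pM2l.
  apply: (@le_trans _ _ (r ^+ 2 + r ^+ 2 / 4)); last first.
    rewrite -subr_ge0.
    have -> : 2 * (r ^+ 2 * (15 / 16)) - (r ^+ 2 + r ^+ 2 / 4) =
      r ^+ 2 * (5 / 8) by field.
    by rewrite mulr_ge0 ?exprn_ge0 ?divr_ge0 // ltW.
  rewrite lerD2l ler_pdivlMr // mulrAC [d * 4]mulrC expr2.
  by rewrite ler_pM2r.
Qed.

Let v p : C := expi (psi R p / 6).
Let d p : C := (2 * sin (psi R p / 2))%:C%C.
Let a p (tau : C) : C := - 'i%C * expi (- psi R p / 6) * tau.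
Let b p (tau : C) : C := 'i%C * expi (psi R p / 6) * (tau^*)%C.

Lemma HformE p tau : Hform p tau = circulant (d p) (a p tau) (b p tau).
Proof. by []. Qed.

Lemma expi_neq0 (x : R) : expi x != 0.
Proof.
apply/eqP => e; have := expiD x (- x).
by rewrite subrr expi0 e mul0r => /eqP; rewrite oner_eq0.
Qed.

Lemma expiN (x : R) : expi (- x) = (expi x)^-1.
Proof. by apply: (mulfI (expi_neq0 x)); rewrite -expiD subrr expi0 divff ?expi_neq0. Qed.

Lemma expi_norm1 (x : R) : expi x * ((expi x)^*)%R = 1.
Proof. by rewrite [X in _ * X](expi_conj x) -expiD subrr expi0. Qed.

Lemma two_sin (x : R) : (2 * sin x)%:C%C = - 'i%C * (expi x - expi (- x)) :> C.
Proof. by rewrite /expi cosN sinN; simpc; rewrite /=; congr (_ +i* _)%C; ring. Qed.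

Lemma dE p : d p = - 'i%C * (v p ^+ 3 - v p ^- 3).
Proof.
rewrite /d two_sin expiN /v -exprVn -expiMn exprVn -expiMn.
by have -> : 3 * (psi R p / 6) = psi R p / 2 by field.
Qed.

(** [R1] is [v ^- 2] times the reflection [1 + k e1 e1^* H] with [k = i v^3]; conjugation by [J]
    takes e1 to e2, and [J^-1 = J^2]. *)
Lemma pair_in_Gamma p tau : (Gamma p tau)
  (v p ^- 4 *: reflection_pair ('i%C * v p ^+ 3) (d p) (a p tau) (b p tau)).
Proof.
have [[_ _ mulG _] _] := Gamma_subgroup p tau.
have GR : Gamma p tau (R1 p tau) by move=> G [_ SG]; apply: SG; left.
have GJ : Gamma p tau (J R) by move=> G [_ SG]; apply: SG; right.
suff <- : R1 p tau *m (J R *m R1 p tau *m (J R *m J R)) =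
  v p ^- 4 *: reflection_pair ('i%C * v p ^+ 3) (d p) (a p tau) (b p tau).
  exact: (mulG _ _ GR (mulG _ _ (mulG _ _ GJ GR) (mulG _ _ GJ GJ))).
have E1 : expi (2 * psi R p / 3) = v p ^+ 4
  by rewrite -expiMn; congr expi; field.
have E2 : expi (psi R p / 3) = v p ^+ 2
  by rewrite -expiMn; congr expi; field.
have E3 : expi (- psi R p / 3) = (v p ^+ 2)^-1
  by rewrite -E2 -expiN; congr expi; field.
have E6 : expi (- psi R p / 6) = (v p)^-1
  by rewrite -expiN; congr expi; field.
have v0 : v p != 0 := expi_neq0 _.
have i2 : 'i%C * 'i%C = -1 :> C by rewrite -expr2 sqr_i.
rewrite dE /a /b /R1 /J E1 E2 E3 E6 -/(v p).
have Ct : (tau^*)%C = (tau^*)%R by [].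
rewrite !Ct; move: 'i%C i2 (v p) (tau^*)%R v0 => im i2 w taub w0.
apply/matrixP => i j; rewrite !(mulmx3E, mxE) /=.
case: i => -[|[|[|//]]] ?; case: j => -[|[|[|//]]] ? /=; field: i2.
all: by [].
Qed.

Lemma complex_archi (x : C) : 0 <= x -> exists k : nat, x < k%:R.
Proof.
move=> x0; have [k xk] : exists k : nat, complex.Re x < k%:R.
  exists (Num.truncn (complex.Re x)).+1; exact: truncnS_gt.
exists k; have -> : k%:R = (k%:R)%:C%C :> C by rewrite rmorph_nat.
by rewrite -(RRe_real (ger0_real x0)) ltcR.
Qed.

Lemma Gamma_not_discrete p (tau z w : C) N :
  @has_signature C 2 1 (Hform p tau) -> 0 < sin (psi R p / 2) ->
  4 * (2 * sin (psi R p / 2))%:C%C <= `|tau| ->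
  z * w = 1 -> z != w -> z ^+ N = 1 -> tau * (tau^*)%R = 2 - z - w ->
  expi (- (N%:R * psi R p)) != 1 -> `|expi (- (N%:R * psi R p)) - 1| <= 8^-1 ->
  ~ discrete_subgroup (SU (Hform p tau)) (Gamma p tau).
Proof.
move=> sig sin0 le_d zw zDw zN tt mu1 mu8 [subG GS iso].
have det0 := det_signature21 sig.
have i2 : 'i%C * 'i%C = -1 :> C by rewrite -expr2 sqr_i.
have d0 : 0 < d p by rewrite /d ltcR mulr_gt0.
have v0 : v p != 0 := expi_neq0 _.
have vN : expi (- psi R p / 6) = (v p)^-1 by rewrite mulNr expiN.
have ab : (a p tau)^* = b p tau.
  have Ci : ('i%C)^* = - 'i%C :> C.
    by apply/eqP; rewrite eq_complex /= oppr0 !eqxx.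
  have Cv : (expi (- psi R p / 6))^* = expi (psi R p / 6).
    by rewrite [LHS]expi_conj mulNr opprK.
  have conj3 (x y t : C) : (- x * y * t)^* = - x^* * y^* * t^*.
    by rewrite !rmorphM rmorphN.
  by rewrite /a conj3 Cv Ci opprK.
have na : `|a p tau| = `|tau|.
  have nv : `|expi (- psi R p / 6)| = 1.
    by apply/eqP; rewrite -(@pexpr_eq1 _ _ 2) // normCK expi_norm1.
  by rewrite /a !normrM normrN nv complexiE normCi !mul1r.
have aa : a p tau * b p tau = 2 - z - w.
  have Ct : (tau^*)%C = (tau^*)%R by [].
  by rewrite -tt /a /b vN Ct -/(v p); field: i2.
have kd : 'i%C * v p ^+ 3 * d p = - ('i%C * v p ^+ 3) ^+ 2 - 1.
  by rewrite dE; field: i2.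
have k0 : 'i%C * v p ^+ 3 != 0.
  by rewrite mulf_neq0 ?expf_neq0 // complexiE neq0Ci.
rewrite HformE in sig det0 GS iso.
have dR : (d p)^* = d p by apply/CrealP/gtr0_real.
have da : 4 * d p <= `|a p tau| by rewrite na.
have [n3 t1 t2] := polar_vec_ratio d0 ab det0 da.
set n := polar_vec _ _ _ in t1 t2 n3.
have n3' : a p tau * b p tau != d p ^+ 2 by rewrite eq_sym -subr_eq0.
have power := reflection_pair_expr k0 kd zw aa dR ab zDw zN n3' (ltr0_neq0 det0).
(* The multiplier [1 + k * d] is [e^(i psi)], so [g^-1] is the [mu] of the Jorgensen sequence. *)
have u6 : 1 + 'i%C * v p ^+ 3 * d p = v p ^+ 6 by rewrite kd; ring: i2.
have gE : ((v p ^+ 6) ^+ N)^-1 = expi (- (N%:R * psi R p)).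
  rewrite expiN -exprM -expiMn natrM; congr ((expi _)^-1); by field.
move: power; rewrite /= u6 gE => power.
set H := circulant _ _ _ in sig det0 GS iso power.
set M := reflection H _ _ in power.
have GM : Gamma p tau ((v p ^- 4) ^+ N * (v p ^+ 6) ^+ N *: M).
  rewrite -scalerA -power -exprZn.
  have := @pair_in_Gamma p tau.
  set Y := _ *: _; have [_ G1 mulG _] := subG => GY.
  elim: (N) => [|k IH]; first by rewrite expr0.
  by rewrite exprS -mulmxE; exact: mulG.
have GJ : Gamma p tau (J R) by move=> G [_ SG]; apply: SG; right.
have n2E : n 2%:R 0 = d p ^+ 2 - a p tau * b p tau by rewrite mxE.
have n2_neq0 : n 2%:R 0 != 0 by rewrite n2E.
have hE x : herm H x n = \det H * x 2%:R 0 by exact: herm_polar_vec.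
have det_neq0 : \det H != 0 by exact: ltr0_neq0.
(* Pairing with [n] reads off the last coordinate up to [\det H], and [J] moves the second
   coordinate to the last place. *)
have tE : herm H (J R *m n) n / herm H n n = n 1 0 / n 2%:R 0.
  rewrite !hE -mulf_div divff // mul1r; congr (_ / _).
  by rewrite mxE sum_ord3 ![J R _ _]mxE /= !mul0r mul1r add0r addr0.
have nv : `|v p| = 1.
  by apply/eqP; rewrite -(@pexpr_eq1 _ _ 2) // normCK expi_norm1.
have lam1 : (v p ^- 4) ^+ N * (v p ^+ 6) ^+ N * ((v p ^- 4) ^+ N * (v p ^+ 6) ^+ N)^* = 1.
  by rewrite -normCK normrM !normrX normfV normrX nv !expr1n invr1 !expr1n mulr1 expr1n.
have h_neq0 : herm H n n != 0 by rewrite hE mulf_neq0.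
rewrite -tE in t1 t2.
exact: (not_isolated_reflection (@complex_archi) (Hform_hermitian p tau)
  h_neq0 (expi_norm1 _) lam1 mu8 mu1 t1 t2 subG GS GM GJ (iso _ GM)).
Qed.
End SporadicGroupPowers.

(** * Moduli of the sporadic values, and large [p] *)

Section SporadicValues.
Variable R : realType.
Local Notation C := R[i].
Implicit Types (q r z w c e : C) (x y : R).

(* [2 - t] is the trace of a noncentral element of finite order of SL_2. *)
Definition trace_finite_order t : Prop := exists z w : C,
  [/\ z * w = 1, z != w, z ^+ 420 = 1 & t = 2 - z - w].

Lemma unity_sum0 q m : q ^+ m = 1 -> q != 1 -> \sum_(k < m) q ^+ k = 0.
Proof.
move=> qm q1; have q10 : q - 1 != 0 by rewrite subr_eq0.
by apply: (mulfI q10); rewrite mulr0 -subrX1 qm subrr.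
Qed.

(** The exponent 420 is the least common multiple of the orders 3, 4, 5 and 7 that occur. *)
Lemma trace_finite_order_root z m t : (m %| 420)%N -> z ^+ m = 1 -> z ^+ 2 != 1 ->
  t = 2 - z - z^-1 -> trace_finite_order t.
Proof.
move=> /dvdnP[k kE] zm z2 ->.
have z0 : z != 0.
  apply: contra_neq z2 => z0; have : z ^+ 420 = 1.
    by rewrite kE mulnC exprM zm expr1n.
  by rewrite z0 expr0n /= => /eqP; rewrite eq_sym oner_eq0.
exists z, z^-1; split => //; first by rewrite divff.
  by apply: contra_neq z2 => e; rewrite expr2 {2}e divff.
by rewrite kE mulnC exprM zm expr1n.
Qed.

Lemma trace_finite_order2 : trace_finite_order 2.
Proof.
have i2 : 'i%C * 'i%C = -1 :> C by rewrite -expr2 sqr_i.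
have i0 : 'i%C != 0 :> C by rewrite complexiE neq0Ci.
apply: (@trace_finite_order_root 'i%C 4) => //.
- by rewrite (_ : 4 = 2 * 2)%N // exprM sqr_i sqrrN expr1n.
- by rewrite sqr_i eq_sym -subr_eq0 opprK (_ : 1 + 1 = 2%:R) ?pnatr_eq0.
- by field: i2.
Qed.

Lemma trace_finite_order3 z : z ^+ 3 = 1 -> z != 1 -> trace_finite_order 3.
Proof.
move=> z3 z1; have z0 : z != 0.
  by apply: contra_eq_neq z3 => ->; rewrite expr0n eq_sym oner_neq0.
have := unity_sum0 z3 z1; rewrite !big_ord_recr big_ord0 /= => s.
have zV : z^-1 = z ^+ 2 by apply: (mulfI z0); rewrite divff // -exprS.
apply: (@trace_finite_order_root z 3) => //.
- by rewrite -zV invr_eq1.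
- rewrite zV; have -> : 2 - z - z ^+ 2 = 3 - (0 + z ^+ 0 + z ^+ 1 + z ^+ 2) by ring.
  by rewrite s subr0.
Qed.

(** As the powers of [q] sum to zero, [3 + q + q^-1 = 2 - q^2 - q^-2]. *)
Lemma trace_finite_order5 q t : q ^+ 5 = 1 -> q != 1 ->
  t = 3 + q + q^-1 -> trace_finite_order t.
Proof.
move=> q5 q1 ->; have q0 : q != 0.
  by apply: contra_eq_neq q5 => ->; rewrite expr0n eq_sym oner_neq0.
have := unity_sum0 q5 q1; rewrite !big_ord_recr big_ord0 /= => s.
have qV : q^-1 = q ^+ 4 by apply: (mulfI q0); rewrite divff // -exprS.
apply: (@trace_finite_order_root (q ^+ 2) 5) => //.
- by rewrite -exprM mulnC exprM q5 expr1n.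
- by rewrite -exprM -qV invr_eq1.
- rewrite -exprVn qV -exprM (_ : q ^+ (4 * 2) = q ^+ 3); last first.
    by rewrite (_ : 4 * 2 = 5 + 3)%N // exprD q5 mul1r.
  apply/eqP; rewrite -subr_eq0; apply/eqP; rewrite -[RHS]s; ring.
Qed.

Lemma trace_finite_order7 q t : q ^+ 7 = 1 -> q != 1 ->
  t = 3 + q + q^-1 + q ^+ 2 + q ^- 2 -> trace_finite_order t.
Proof.
move=> q7 q1 ->; have q0 : q != 0.
  by apply: contra_eq_neq q7 => ->; rewrite expr0n eq_sym oner_neq0.
have := unity_sum0 q7 q1; rewrite !big_ord_recr big_ord0 /= => s.
have qV : q^-1 = q ^+ 6 by apply: (mulfI q0); rewrite divff // -exprS.
have qX n m : q ^+ (7 * n + m) = q ^+ m by rewrite exprD exprM q7 expr1n mul1r.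
(* The vanishing sum of the seven powers of [q] turns [t] into [2 - q^3 - q^-3]. *)
apply: (@trace_finite_order_root (q ^+ 3) 7) => //.
- by rewrite -exprM mulnC exprM q7 expr1n.
- by rewrite -exprM -qV invr_eq1.
- rewrite -!exprVn qV -!exprM (qX 1 5) (qX 2 4).
  apply/eqP; rewrite -subr_eq0; apply/eqP; rewrite -[RHS]s; ring.
Qed.

Lemma expi_neq1 x : 0 < x < pi -> expi x != 1.
Proof.
move=> /sin_gt0_pi sx; apply/eqP => /eqP; rewrite eq_complex /= => /andP[_ /eqP s0].
by rewrite s0 ltxx in sx.
Qed.

Lemma expi_pi : expi (pi : R) = -1.
Proof. by rewrite /expi cospi sinpi; apply/eqP; rewrite eq_complex /= oppr0 !eqxx. Qed.

Lemma expi_unity_root n m x : m%:R * x = 2 * n%:R * pi -> expi x ^+ m = 1.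
Proof.
by move=> e; rewrite -expiMn e -natrM expiMn expi_pi exprM sqrrN !expr1n.
Qed.

Lemma two_cos x : (2 * cos x)%:C%C = expi x + (expi x)^-1 :> C.
Proof. by rewrite -expiN /expi cosN sinN; simpc; rewrite /=; congr (_ +i* _)%C; ring. Qed.

Lemma normsq_rotate e c x : e * (e^*)%R = 1 ->
  (e * (c + x%:C%C)) * ((e * (c + x%:C%C))^*)%R = (c + x%:C%C) * ((c^*)%R + x%:C%C).
Proof.
have xR : (x%:C%C)^*%R = x%:C%C :> C.
  by apply/eqP; rewrite eq_complex /= oppr0 !eqxx.
by move=> e1; rewrite rmorphM rmorphD /= xR mulrACA e1 mul1r.
Qed.

(* [sigma_1, sigma_2, sigma_3] are rotations of [i + 2 cos y]. *)
Lemma normsq_sigma123 y :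
  let s := expi (pi / 3) + expi (- pi / 6) * (2 * cos y)%:C%C in
  s * (s^*)%R = 3 + expi y ^+ 2 + (expi y ^+ 2)^-1 :> C.
Proof.
have ei : expi (pi / 2) = 'i%C :> C by rewrite /expi cos_pihalf sin_pihalf.
have -> : expi (pi / 3) = expi (- pi / 6) * 'i%C :> C.
  by rewrite -ei -expiD; congr expi; field.
move=> s; rewrite /s -mulrDr normsq_rotate ?expi_norm1 // two_cos.
have -> : ('i%C)^*%R = - 'i%C :> C.
  by apply/eqP; rewrite eq_complex /= oppr0 !eqxx.
have i2 : 'i%C * 'i%C = -1 :> C by rewrite -expr2 sqr_i.
by have y0 := expi_neq0 y; field: i2.
Qed.

(* [sigma_5, ..., sigma_9] are rotations of [e^(i pi / 3) + 2 cos y]. *)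
Lemma normsq_sigma59 y :
  let s := expi (2 * pi / 9) + expi (- pi / 9) * (2 * cos y)%:C%C in
  s * (s^*)%R = 3 + expi y + (expi y)^-1 + expi y ^+ 2 + expi y ^- 2 :> C.
Proof.
have -> : expi (2 * pi / 9) = expi (- pi / 9) * expi (pi / 3) :> C.
  by rewrite -expiD; congr expi; field.
move=> s; rewrite /s -mulrDr normsq_rotate ?expi_norm1 // two_cos.
rewrite [(expi (pi / 3))^*]expi_conj expiN.
have c0 := expi_neq0 (pi / 3 : R).
have c1 : expi (pi / 3) + 1 != 0 :> C.
  apply/eqP => /eqP; rewrite eq_complex /= => /andP[_].
  rewrite addr0 gt_eqF //; apply: sin_gt0_pi.
  have := pi_gt0 R => p0; lra.
(* A primitive sixth root of unity [c]: cancel [c + 1] in [c^3 + 1 = 0]. *)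
have c2 : expi (pi / 3) ^+ 2 = expi (pi / 3) - 1 :> C.
  have : expi (pi / 3) ^+ 3 = - 1 :> C.
    by rewrite -expiMn -expi_pi; congr expi; field.
  move=> c3; apply: (mulfI c1); apply/eqP; rewrite -subr_eq0; apply/eqP.
  by ring: c3.
have -> : (expi (pi / 3))^-1 = 1 - expi (pi / 3) :> C.
  by apply: (mulfI c0); rewrite divff //; ring: c2.
by have y0 := expi_neq0 y; field: c2.
Qed.

(** The exponents 1, 2, 4 form a perfect difference set modulo 7: each nonzero residue is a
    difference exactly once, so the product is 3 plus the sum of the nontrivial powers of [q], which
    is -1. *)
Lemma normsq_sigma4 q : q ^+ 7 = 1 -> q != 1 -> q * (q^*)%R = 1 ->
  let s := q + q ^+ 2 + q ^+ 4 in s * (s^*)%R = 2.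
Proof.
move=> q7 q1 qq s; have q0 : q != 0.
  by apply: contra_eq_neq q7 => ->; rewrite expr0n eq_sym oner_neq0.
have := unity_sum0 q7 q1; rewrite !big_ord_recr big_ord0 /= => S.
have qc : (q^*)%R = q ^+ 6 by apply: (mulfI q0); rewrite qq -exprS.
rewrite /s !rmorphD !rmorphXn /= qc.
have -> : 2 = 2 + (0 + q ^+ 0 + q ^+ 1 + q ^+ 2 + q ^+ 3 + q ^+ 4 + q ^+ 5
  + q ^+ 6) by rewrite S addr0.
ring: q7.
Qed.

(** The squared modulus is 3 for sigma_1, [3 + q + q^-1] with [q] of order 5 for sigma_2 and
    sigma_3, 2 for sigma_4 to sigma_6, and [3 + q + q^-1 + q^2 + q^-2] with [q] of order 7 for the
    others. *)
Lemma sporadic_normsq (tau : C) :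
  sporadic_value tau -> trace_finite_order (tau * (tau^*)%R).
Proof.
have p0 := pi_gt0 R.
case=> s ss st; suff: trace_finite_order (s * (s^*)%R).
  have conjE t : (t^*)%C = (t^*)%R :> C by [].
  by case: st => [->|->] //; rewrite conjE conjCK mulrC.
(* All four nontrivial fifth roots of unity occur here, so the value is [3 - 1 = 2]. *)
have order5 y : expi y ^+ 5 = 1 :> C -> expi y != 1 :> C ->
    trace_finite_order (3 + expi y + (expi y)^-1 + expi y ^+ 2 + expi y ^- 2).
  move=> q5 q1; have q0 := expi_neq0 y.
  have := unity_sum0 q5 q1; rewrite !big_ord_recr big_ord0 /= => S.
  have qV : (expi y)^-1 = expi y ^+ 4 by apply: (mulfI q0); rewrite divff // -exprS.
  rewrite (_ : _ + _ = 2); first exact: trace_finite_order2.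
  rewrite -exprVn qV -exprM (_ : expi y ^+ (4 * 2) = expi y ^+ 3); last first.
    by rewrite (_ : 4 * 2 = 5 + 3)%N // exprD q5 mul1r.
  by apply/eqP; rewrite -subr_eq0; apply/eqP; rewrite -[RHS]S; ring.
have root n m (x : R) : m%:R * x = 2 * n%:R * pi -> expi x ^+ m = 1 :> C.
  exact: expi_unity_root.
have sq x : expi x ^+ 2 = expi (x *+ 2) :> C by rewrite -expiMn mulr_natl.
move: ss; rewrite !inE.
case/orP => [/eqP->|].
  rewrite normsq_sigma123 sq.
  have -> : expi (pi / 4 *+ 2) = 'i%C :> C.
    have -> : pi / 4 *+ 2 = pi / 2 :> R by rewrite -mulr_natr; field.
    by rewrite /expi cos_pihalf sin_pihalf.
  have i2 : 'i%C * 'i%C = -1 :> C by rewrite -expr2 sqr_i.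
  have i0 : 'i%C != 0 :> C by rewrite complexiE neq0Ci.
  rewrite (_ : 3 + 'i%C + 'i%C^-1 = 3 :> C); last by field: i2.
  apply: (@trace_finite_order3 (expi (2 * pi / 3))).
    by apply: (root 1); field.
  apply: expi_neq1; lra.
case/orP => [/eqP->|].
  rewrite normsq_sigma123 sq.
  apply: (@trace_finite_order5 (expi (pi / 5 *+ 2))) => //.
    by apply: (root 1); rewrite -mulr_natr; field.
  by apply: expi_neq1; rewrite -mulr_natr; lra.
case/orP => [/eqP->|].
  rewrite normsq_sigma123 sq.
  apply: (@trace_finite_order5 (expi (2 * pi / 5 *+ 2))) => //.
    by apply: (root 2); rewrite -mulr_natr; field.
  by apply: expi_neq1; rewrite -mulr_natr; lra.
case/orP => [/eqP->|].
  have e2 : expi (4 * pi / 7) = expi (2 * pi / 7) ^+ 2 :> C.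
    by rewrite sq -mulr_natr; congr expi; field.
  have e4 : expi (8 * pi / 7) = expi (2 * pi / 7) ^+ 4 :> C.
    by rewrite -expiMn; congr expi; field.
  rewrite e2 e4 normsq_sigma4; first exact: trace_finite_order2.
  - by apply: (root 1); field.
  - by apply: expi_neq1; lra.
  - exact: expi_norm1.
case/orP => [/eqP->|].
  rewrite normsq_sigma59; apply: order5; first by apply: (root 1); field.
  by apply: expi_neq1; lra.
case/orP => [/eqP->|].
  rewrite normsq_sigma59; apply: order5; first by apply: (root 2); field.
  by apply: expi_neq1; lra.
have order7 n y : 7 * y = 2 * n%:R * pi -> 0 < y < pi ->
    trace_finite_order (3 + expi y + (expi y)^-1 + expi y ^+ 2 + expi y ^- 2).
  by move=> /root q7 /expi_neq1 q1; apply: (trace_finite_order7 q7 q1).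
case/orP => [/eqP->|].
  by rewrite normsq_sigma59; apply: (order7 1); [field | lra].
case/orP => [/eqP->|/eqP->].
  by rewrite normsq_sigma59; apply: (order7 2); [field | lra].
by rewrite normsq_sigma59; apply: (order7 3); [field | lra].
Qed.

(** With [z * w = 1], the equation [z + w = 2] would give [(z - 1)^2 = 0], hence [z = w]. This makes
    [|tau|] positive, so that [4 * d <= |tau|] holds for large [p]. *)
Lemma trace_finite_order_neq0 t : trace_finite_order t -> t != 0.
Proof.
case=> z [w [zw zDw _ ->]]; apply: contra_neq zDw => e.
have wE : w = 2 - z by rewrite -[RHS]subr0 -e; ring.
have : (z - 1) ^+ 2 = 0.
  by rewrite (_ : _ ^+ 2 = 1 - z * w); [rewrite zw subrr | rewrite wE; ring].
by move/eqP; rewrite sqrf_eq0 subr_eq0 => /eqP z1; rewrite wE z1; ring.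
Qed.

Lemma cos_sin_near0 (eps : R) : 0 < eps -> exists2 del : R, 0 < del &
  forall x, `|x| < del -> `|cos x - 1| < eps /\ `|sin x| < eps.
Proof.
move=> e0.
have /cvgrPdist_lt/(_ _ e0) c1 := @continuous_cos R 0.
have /cvgrPdist_lt/(_ _ e0) s1 := @continuous_sin R 0.
have [del /= d0 sub] := (nbhs_ballP _ _).1 (filterI c1 s1); exists del => // x xd.
have := sub x; rewrite /ball /= sub0r normrN => /(_ xd) [].
by rewrite cos0 sin0 sub0r normrN distrC.
Qed.

Lemma expi_near1 x (eps : R) : `|cos x - 1| < eps -> `|sin x| < eps ->
  `|expi x - 1| <= (2 * eps)%:C%C.
Proof.
rewrite !ltr_norml => ce se.
have e0 : 0 <= 2 * eps by lra.
rewrite normc_def lecR /= oppr0 addr0 -[leRHS]ger0_norm // -sqrtr_sqr.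
by apply: ler_wsqrtr; nra.
Qed.

Lemma psi_small (del : R) : 0 < del ->
  exists P, forall p, (P <= p)%N -> 0 < psi R p < del.
Proof.
move=> d0; have p0 := pi_gt0 R.
exists (Num.truncn (2 * pi / del)).+1 => p Pp.
have pp : 0 < p%:R :> R by rewrite ltr0n (leq_trans _ Pp).
rewrite /psi divr_gt0 ?mulr_gt0 //= ltr_pdivrMr // [ltRHS]mulrC -ltr_pdivrMr //.
by apply: (lt_le_trans (truncnS_gt _)); rewrite ler_nat.
Qed.

Lemma sporadic_not_discrete_large (tau : C) : sporadic_value tau ->
  exists P, forall p, (P <= p)%N -> sporadic_pair p tau ->
    ~ discrete_subgroup (SU (Hform p tau)) (Gamma p tau).
Proof.
move=> /sporadic_normsq tt.
have tau0 : tau != 0.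
  by apply: contraNneq (trace_finite_order_neq0 tt) => ->; rewrite mul0r.
case: tt => z [w [zw zDw zN tt]].
have [r r0 nr] : exists2 r : R, 0 < r & `|tau| = r%:C%C.
  exists (complex.Re `|tau|); last by rewrite RRe_real // ger0_real.
  by rewrite -(@ltcR R) RRe_real ?ger0_real // normr_gt0.
have p0 := pi_gt0 R.
(* The bound [r / 8] serves [8 sin(psi / 2) <= |tau|]; [expi_near1] doubles 1/16 to the required
   1/8. *)
have e0 : 0 < Num.min (r / 8) (16^-1) by rewrite lt_min; apply/andP; split; lra.
have [del d0 near0] := cos_sin_near0 e0.
(* The bound [pi / 420] keeps [420 psi] strictly between 0 and [pi], so that [mu != 1]; [del / 420]
   brings [mu] near 1. *)
have d0' : 0 < Num.min (pi / 420) (del / 420) by rewrite lt_min; apply/andP; split; lra.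
have [P PP] := psi_small d0'.
exists P => p /PP /andP[psi0]; rewrite lt_min => /andP[psi_pi psi_del].
case=> _ _ sig; have psiN : 420 * psi R p < del by lra.
apply: (Gamma_not_discrete (N := 420) sig _ _ zw zDw zN tt).
- by apply: sin_gt0_pi; lra.
- have [|_] := near0 (psi R p / 2); first by rewrite gtr0_norm; lra.
  rewrite lt_min => /andP[+ _]; rewrite ltr_norml => /andP[_ s8].
  rewrite nr (_ : 4 * _ = (4 * (2 * sin (psi R p / 2)))%:C%C); last first.
    by rewrite [RHS]rmorphM /= rmorph_nat.
  by rewrite lecR; lra.
- have : expi (420 * psi R p) != 1 by apply: expi_neq1; lra.
  by rewrite expiN invr_eq1.
- have [|c16 s16] := near0 (- (420 * psi R p)).
    by rewrite normrN gtr0_norm; lra.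
  apply: (le_trans (expi_near1 c16 s16)).
  have -> : 8^-1 = (8^-1)%:C%C :> C by rewrite fmorphV /= rmorph_nat.
  rewrite lecR; have : Num.min (r / 8) 16^-1 <= 16^-1 by rewrite ge_min lexx orbT.
  lra.
Qed.

End SporadicValues.

(** * From a bound on [p] for each value to finitely many pairs *)

Lemma uniform_bound (T : eqType) (Q : nat -> T -> Prop) (s : seq T) :
  (forall t, t \in s -> exists P, forall p, (P <= p)%N -> Q p t) ->
  exists P, forall t p, t \in s -> (P <= p)%N -> Q p t.
Proof.
elim: s => [|x s IH] bs; first by exists 0.
have [P1 h1] := bs x (mem_head _ _).
have [t ts|P2 h2] := IH; first by apply: bs; rewrite inE ts orbT.
exists (maxn P1 P2) => t p; rewrite inE geq_max => /orP[/eqP->|ts] /andP[p1 p2].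
  exact: h1.
exact: h2.
Qed.

Lemma finite_bounded_pairs (T : choiceType) (A : set (nat * T)) P (s : seq T) :
  (forall q, A q -> (q.1 < P)%N /\ q.2 \in s) -> finite_set A.
Proof.
move=> AP; pose l := [seq (p, t) | p <- iota 0 P, t <- s].
apply: (@sub_finite_set _ _ [set` l]); last exact: finite_seq.
move=> [p t] /AP /= [pP ts].
by apply/allpairsP; exists (p, t); split; rewrite ?mem_iota.
Qed.

Theorem theorem1p2 (R : realType) :
  finite_set [set q : nat * R[i] |
    sporadic_pair q.1 q.2 /\
    discrete_subgroup (SU (Hform q.1 q.2)) (Gamma q.1 q.2)].
Proof.
pose L : seq R[i] := sigmas R ++ [seq (s^*)%C | s <- sigmas R].
have LP t : sporadic_value t <-> t \in L.
  rewrite mem_cat; split.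
    by case=> s ss [->|->]; rewrite ?ss // map_f ?orbT.
  case/orP=> [ts|/mapP[s ss ->]]; first by exists t => //; left.
  by exists s => //; right.
have [P hP] := uniform_bound (fun t tL => sporadic_not_discrete_large ((LP t).2 tL)).
apply: (@finite_bounded_pairs _ _ P L) => -[p t] [/= sp disc].
have [_ /LP tL _] := sp; split => //.
by rewrite ltnNge; apply/negP => Pp; exact: hP tL Pp sp disc.
Qed.
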